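(* Let $p=\sum_\alpha c_\alpha x^\alpha\in\mathbb{R}[x_1,\dots,x_n]$ be SOS, let $Q\subseteq\mathbb{Z}_+^n$ satisfy $\mathrm{SOSS}(p,Q)$, and let $T\subseteq V(p,Q)$. If $\psi_Q(\alpha+\beta)\subseteq T$ for all $\alpha,\beta\in\sigma(T)$, then the polynomial $$p_1=\sum_{\alpha\in S(p),\ \psi_Q(\alpha)\subseteq T} c_\alpha x^\alpha$$ is SOS.
   Context: Polynomials have real coefficients. A polynomial $p\in\mathbb{R}[x_1,\dots,x_n]$ is SOS if $p=\sum_{i=1}^s q_i^2$ for some finitely many $q_1,\dots,q_s\in\mathbb{R}[x_1,\dots,x_n]$. $\mathbb{Z}_+$ is the set of non-negative integers. The support $S(p)\subseteq\mathbb{Z}_+^n$ of $p=\sum_\alpha c_\alpha x^\alpha$ is the set of exponent vectors with nonzero coefficient. A set $Q\subseteq\mathbb{Z}_+^n$ satisfies the relation $\mathrm{SOSS}(p,Q)$ if: whenever $p$ is SOS, there exist $q_1,\dots,q_s$ with $p=\sum_{i=1}^s q_i^2$ and $S(q_i)\subseteq Q$ for all $i$. $Q+Q$ is the Minkowski sum. For $\alpha\in Q+Q$ let $\varphi_Q(\alpha)=\{\beta\in Q\mid \exists\gamma\in Q,\ \beta+\gamma=\alpha\}$. For $Q$ satisfying $\mathrm{SOSS}(p,Q)$ let $V(p,Q)=\{\alpha\in Q\mid \varphi_Q(2\alpha)=\{\alpha\}\}$. The map $\psi_Q$ assigns to each vector $\alpha$ a subset of $V(p,Q)$: $\psi_Q(\alpha)=\emptyset$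 if $\alpha\notin Q+Q$, and for $\alpha\in Q+Q$, $$\psi_Q(\alpha)=\begin{cases}\{\tfrac12\alpha\} & \text{if }\varphi_Q(\alpha)=\{\tfrac12\alpha\},\\ \bigcup_{\beta,\gamma\in Q,\ \beta\neq\gamma,\ \beta+\gamma=\alpha}\bigl(\psi_Q(2\beta)\cup\psi_Q(2\gamma)\bigr) & \text{otherwise,}\end{cases}$$ where $(\psi_Q(\alpha))_\alpha$ is the least family (with respect to inclusion) satisfying these equations. For $T\subseteq V(p,Q)$ let $\sigma(T)=\{\gamma\in Q\mid \psi_Q(2\gamma)\subseteq T\}$. *)

(* Defs.v *)
From HB Require Import structures.
From mathcomp Require Import all_boot all_order all_algebra.
From mathcomp Require Import boolp classical_sets reals.
From mathcomp Require Import mpoly.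

Set Implicit Arguments.
Unset Strict Implicit.
Unset Printing Implicit Defensive.

Import GRing.Theory.

Local Open Scope classical_set_scope.
Local Open Scope ring_scope.

Definition SOS (R : realType) (n : nat) (p : {mpoly R[n]}) : Prop :=
  exists qs : seq {mpoly R[n]}, p = \sum_(q <- qs) q ^+ 2.

Definition SOSS (R : realType) (n : nat) (p : {mpoly R[n]})
    (Q : set 'X_{1..n}) : Prop :=
  SOS p ->
  exists qs : seq {mpoly R[n]},
    p = \sum_(q <- qs) q ^+ 2 /\
    (forall q, q \in qs -> [set` msupp q] `<=` Q).

Definition minkowski (n : nat) (A B : set 'X_{1..n}) : set 'X_{1..n} :=
  [set (b + g)%MM | b in A & g in B].

Definition phi (n : nat) (Q : set 'X_{1..n}) (a : 'X_{1..n}) :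
    set 'X_{1..n} :=
  [set b | Q b /\ exists g, Q g /\ (b + g)%MM = a].

(* V(p, Q); nothing in it depends on p. *)
Definition V (n : nat) (Q : set 'X_{1..n}) : set 'X_{1..n} :=
  [set a | Q a /\ phi Q (a *+ 2)%MM = [set a]].

(* phi_Q(a) = {a / 2}; the half of a is the b with 2 b = a, if there is one,
   and the condition fails when a has an odd coordinate. *)
Definition phi_half (n : nat) (Q : set 'X_{1..n}) (a : 'X_{1..n}) : Prop :=
  exists b, (b *+ 2)%MM = a /\ phi Q a = [set b].

Inductive psi (n : nat) (Q : set 'X_{1..n}) :
    'X_{1..n} -> 'X_{1..n} -> Prop :=
| psi_half a b :
    minkowski Q Q a -> (b *+ 2)%MM = a -> phi Q a = [set b] -> psi Q a b
| psi_left a b g d :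
    minkowski Q Q a -> ~ phi_half Q a ->
    Q b -> Q g -> b <> g -> (b + g)%MM = a ->
    psi Q (b *+ 2)%MM d -> psi Q a d
| psi_right a b g d :
    minkowski Q Q a -> ~ phi_half Q a ->
    Q b -> Q g -> b <> g -> (b + g)%MM = a ->
    psi Q (g *+ 2)%MM d -> psi Q a d.

(* The families of subsets of V(p, Q) satisfying the equations of psi_Q;
   psi_familyP and psi_min show that psi Q is the least of them. *)
Definition psi_family (n : nat) (Q : set 'X_{1..n})
    (F : 'X_{1..n} -> set 'X_{1..n}) : Prop :=
  forall a,
    [/\ F a `<=` V Q,
        ~ minkowski Q Q a -> F a = set0,
        forall b, minkowski Q Q a -> (b *+ 2)%MM = a -> phi Q a = [set b] ->
          F a = [set b]
      & minkowski Q Q a -> ~ phi_half Q a ->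
          F a = \bigcup_(bg in [set bg : 'X_{1..n} * 'X_{1..n} |
                    [/\ Q bg.1, Q bg.2, bg.1 <> bg.2
                      & (bg.1 + bg.2)%MM = a]])
                  (F (bg.1 *+ 2)%MM `|` F (bg.2 *+ 2)%MM)].

Lemma psi_familyP (n : nat) (Q : set 'X_{1..n}) : psi_family Q (psi Q).
Proof.
move=> a; split.
- move=> d; elim=> // {}a b _ ba phia.
  have : phi Q a b by rewrite phia.
  by case=> Qb _; split=> //; rewrite ba.
- by move=> aQ; rewrite -subset0 => d psid; case: psid aQ => ? *; tauto.
- move=> b aQ ba phia; apply/seteqP; split=> [d psid|d ->]; last first.
    exact: psi_half.
  have nh : ~ ~ phi_half Q a by apply; exists b.
  case: psid phia nh => //.
  move=> a' b' _ _ -> e _.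
  by have : [set b] b' by rewrite -e.
- move=> aQ nh; apply/seteqP; split=> d.
  + move=> psid; case: psid aQ nh => [a' b _ ba phia _ []
      |a' b g d' _ _ Qb Qg bg bga pd _ _|a' b g d' _ _ Qb Qg bg bga pd _ _].
    * by exists b.
    * by exists (b, g) => //; left.
    * by exists (b, g) => //; right.
  + case=> [[b g]] [/= Qb Qg bg bga] [pd|pd].
    * exact: (psi_left aQ nh Qb Qg bg bga pd).
    * exact: (psi_right aQ nh Qb Qg bg bga pd).
Qed.

Lemma psi_min (n : nat) (Q : set 'X_{1..n}) (F : 'X_{1..n} -> set 'X_{1..n}) :
  psi_family Q F -> forall a, psi Q a `<=` F a.
Proof.
move=> FQ a d; elim=> {a d} [a b aQ ba phia|a b g d aQ nh Qb Qg bg bga _ Fd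
                            |a b g d aQ nh Qb Qg bg bga _ Fd].
- by have [_ _ Fa _] := FQ a; rewrite (Fa b).
- by have [_ _ _ -> //] := FQ a; exists (b, g) => //; left.
- by have [_ _ _ -> //] := FQ a; exists (b, g) => //; right.
Qed.

Definition sigma (n : nat) (Q T : set 'X_{1..n}) : set 'X_{1..n} :=
  [set g | Q g /\ psi Q (g *+ 2)%MM `<=` T].

(* Main.v *)
Require Import Defs.
From HB Require Import structures.
From mathcomp Require Import all_boot all_order all_algebra.
From mathcomp Require Import boolp classical_sets reals.
From mathcomp Require Import mpoly.

(** Write [p] as a sum of squares of polynomials [q] supported in [Q], and
    delete from each [q] the monomials outside [sigma Q T].  The sum of the
    squares of the truncated polynomials is the required polynomial.

    The reason is that for [b] and [g] in [Q], [psi Q (b + g)] is contained in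
    [T] if and only if both [b] and [g] lie in [sigma Q T].  The hypothesis on
    [T] is one direction.  For the other ([psi_double_sub]), the equations of
    [psi] make [psi Q (b + g)] contain [psi Q (2 b)] and [psi Q (2 g)].  Hence
    in the expansion of each [q ^+ 2], the products of two kept monomials are
    exactly those that land on an exponent kept in [p]; no exponent receives
    both kept and deleted products, so truncation commutes with the squaring
    ([mtruncM]) and, being linear, with the sum of squares. *)

Set Implicit Arguments.
Unset Strict Implicit.

Import GRing.Theory.
Local Open Scope classical_set_scope.
Local Open Scope ring_scope.

(** A sum of two distinct elements of [Q] falls under the recursive equation
    of [psi], which takes in the values of [psi] at their doubles. *)
Lemma psi_double_sub (n : nat) (Q : set 'X_{1..n}) (b g : 'X_{1..n}) :
  Q b -> Q g -> psi Q (b *+ 2)%MM `<=` psi Q (b + g)%MM.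
Proof.
move=> Qb Qg; have [<-|/eqP bg] := eqVneq b g; first by rewrite mulmS mulm1n.
have bgQ : minkowski Q Q (b + g)%MM by exists b => //; exists g.
have nhalf : ~ phi_half Q (b + g)%MM.
  (* [b] and [g] are two distinct elements of [phi Q (b + g)]. *)
  move=> [c [_ phic]]; apply: bg.
  have -> : b = c by rewrite -[_ = _]/([set c] b) -phic; split=> //; exists g.
  have -> // : g = c.
  by rewrite -[_ = _]/([set c] g) -phic; split=> //; exists b; rewrite addmC.
by move=> d; exact: (@psi_left _ _ _ b g).
Qed.

Definition mtrunc (R : nzRingType) (n : nat) (P : pred 'X_{1..n})
    (p : {mpoly R[n]}) : {mpoly R[n]} :=
  \sum_(a <- msupp p | P a) p@_a *: 'X_[a].

Lemma mcoeff_mtrunc (R : nzRingType) (n : nat) (P : pred 'X_{1..n})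
    (p : {mpoly R[n]}) (a : 'X_{1..n}) :
  (mtrunc P p)@_a = if P a then p@_a else 0.
Proof.
rewrite /mtrunc raddf_sum /=.
under eq_bigr do rewrite mcoeffZ mcoeffX.
have [ap|ap] := boolP (a \in msupp p).
  rewrite big_mkcond (bigD1_seq a) //= eqxx mulr1 big1 ?addr0 // => b /negPf ->.
  by rewrite mulr0 if_same.
rewrite (memN_msupp_eq0 ap) if_same big_seq_cond big1 // => b /andP[bp _].
by case: eqP bp ap => [->->//|_ _ _]; rewrite mulr0.
Qed.

Lemma mtrunc_sum (R : nzRingType) (n : nat) (P : pred 'X_{1..n}) (I : Type)
    (r : seq I) (f : I -> {mpoly R[n]}) :
  mtrunc P (\sum_(i <- r) f i) = \sum_(i <- r) mtrunc P (f i).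
Proof.
apply/mpolyP => a; rewrite mcoeff_mtrunc !raddf_sum /=.
under [RHS]eq_bigr do rewrite mcoeff_mtrunc.
by case: (P a); last rewrite big1.
Qed.

(** The hypothesis rules out cancellation between kept and deleted terms: the
    pairs [(b, g)] contributing to the coefficient of one exponent of [p * q]
    are all kept or all deleted, up to pairs whose contribution is zero. *)
Lemma mtruncM (R : nzRingType) (n : nat) (P S : pred 'X_{1..n})
    (p q : {mpoly R[n]}) :
  {in msupp p & msupp q, forall b g, P (b + g)%MM = S b && S g} ->
  mtrunc P (p * q) = mtrunc S p * mtrunc S q.
Proof.
move=> PS; apply/mpolyP => a; rewrite mcoeff_mtrunc !mcoeffM.
(* [if c then x else 0] as [x *+ c], to move the test inside the sum. *)
rewrite -[if _ then _ else _]mulrb -sumrMnl.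
apply: eq_bigr => -[b g] /= /eqP abg.
have {abg} -> : P a = P (b + g)%MM by rewrite -abg.
rewrite !mcoeff_mtrunc mulrb.
have [bp|/memN_msupp_eq0 ->] := boolP (bmnm b \in msupp p); last first.
  by rewrite if_same !mul0r if_same.
have [gq|/memN_msupp_eq0 ->] := boolP (bmnm g \in msupp q); last first.
  by rewrite if_same !mulr0 if_same.
by rewrite PS //; case: (S b); case: (S g); rewrite ?mulr0 ?mul0r.
Qed.

Theorem theorem3 (R : realType) (n : nat) (p : {mpoly R[n]})
    (Q T : set 'X_{1..n}) (p_sos : SOS p) (pQ : SOSS p Q) (TV : T `<=` V Q)
    (psiT : forall a b : 'X_{1..n}, sigma Q T a -> sigma Q T b ->
       psi Q (a + b)%MM `<=` T) :
  SOS (\sum_(a <- msupp p | `[< psi Q a `<=` T >]) p@_a *: 'X_[a]).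
Proof.
have [qs [p_qs qsQ]] := pQ p_sos.
exists [seq mtrunc (fun a => `[< sigma Q T a >]) q | q <- qs].
rewrite -/(mtrunc (fun a => `[< psi Q a `<=` T >]) p) [RHS]big_map.
rewrite p_qs mtrunc_sum; apply: eq_big_seq => q /qsQ qQ.
apply: mtruncM => b g /qQ Qb /qQ Qg; rewrite -asbool_and.
apply: asbool_equiv_eq; split=> [bgT|[]]; last exact: psiT.
split; split=> //; apply: subset_trans bgT; first exact: psi_double_sub.
by rewrite addmC; exact: psi_double_sub.
Qed.
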